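(* Let $K$ be a real-valued field with a subring $A$, let $A^\circ=A\cap K^\circ$, and let $\|\ \|_\Omega$ denote the Kähler seminorm on the $K$-vector space $\Omega_{K/A}$. Then: (i) Localization induces an isomorphism $\Omega^{\log}_{K^\circ/A^\circ}\otimes_{K^\circ}K=\Omega_{K/A}$. In particular, one can naturally view the torsion-free quotient $(\Omega^{\log}_{K^\circ/A^\circ})_{\mathrm{tf}}$ as a semilattice in $\Omega_{K/A}$. (ii) $\|\ \|_\Omega$ is the maximal $K$-seminorm on $\Omega_{K/A}$ whose unit ball contains $(\Omega^{\log}_{K^\circ/A^\circ})_{\mathrm{tf}}$. In particular, $(\Omega^{\log}_{K^\circ/A^\circ})_{\mathrm{tf}}$ is an almost unit ball of $\|\ \|_\Omega$.
   Context: A real-valued field is a field $K$ with a non-archimedean valuation $|\ |:K\to\mathbb{R}_{\ge 0}$ (possibly trivial, not necessarily complete); $K^\circ=\{|x|\le 1\}$ is its ring of integers. All seminorms are non-archimedean; a $K$-seminorm on a $K$-vector space $V$ satisfies $\|v-w\|\le\max(\|v\|,\|w\|)$, $\|0\|=0$ and $\|av\|\le|a|\,\|v\|$ for $a\in K$, and its unit ball is $V^\diamond=\{v:\|v\|\le 1\}$, a $K^\circ$-module. The Kähler seminorm on $\Omega_{K/A}$ is $\|x\|_\Omega=\inf\max_i|c_i|\,|b_i|$, the infimum being over all finite representations $x=\sum_i c_i\,d(b_i)$ with $c_i,b_i\in K$. $\Omega^{\log}_{K^\circ/A^\circ}$ is the module of logarithmic differentials of the log ring $(K^\circ,K^\circ\setminus\{0\})$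 over the log ring $(A^\circ,A^\circ\setminus\{0\})$: it is the quotient of $\Omega_{K^\circ/A^\circ}\oplus(K^\circ\otimes_{\mathbb{Z}}K^\times)$ by the $K^\circ$-submodule generated by the elements $(0,1\otimes a)$ with $a\in A^\circ\setminus\{0\}$ and $(d(b),-b\otimes b)$ with $b\in K^\circ\setminus\{0\}$. The image of $1\otimes b$ is denoted $\delta b$, so that $b\,\delta b=db$; in $\Omega_{K/A}$ the element $\delta b$ becomes $db/b$. For a $K^\circ$-module $M$, $M_{\mathrm{tor}}$ is the submodule of elements with non-zero annihilator and $M_{\mathrm{tf}}=M/M_{\mathrm{tor}}$. A $K^\circ$-submodule $M$ of a $K$-vector space $V$ is a semilattice if $M\otimes_{K^\circ}K=V$. An element $x$ of a $K^\circ$-module is almost zero if for any $r<1$ there is $\pi\in K^\circ$ with $r<|\pi|$ and $\pi x=0$; a module is almost zero if all its elements are; a homomorphism is an almost isomorphism if its kernel and cokernel are almost zero. Two submodules $M,M'$ of $V$ are almost isomorphic as submodules if both embeddings $M\hookrightarrow M+M'$ and $M'\hookrightarrow M+M'$ are almost isomorphisms. A $K^\circ$-submodule $M\subseteq V$ is an almost unit ball of a seminorm on $V$ if $M$ is almost isomorphic, as a submodule, to the unit ball $V^\diamond$.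
   Formalization: In (i), the isomorphism and the embedding of the torsion-free quotient are proved only when A lies in the fraction field of A° (they fail for A=k[1/t] in k(t), t-adic); the semilattice claim and (ii) are proved for every A, for the image of the torsion-free quotient in Ω_{K/A}. *)

(* Defs.v *)
From HB Require Import structures.
From mathcomp Require Import all_boot all_order all_algebra.
From mathcomp Require Import boolp classical_sets reals.
From mathcomp.multinomials Require Import freeg.

Set Implicit Arguments.
Unset Strict Implicit.
Unset Printing Implicit Defensive.

Import Order.TTheory GRing.Theory Num.Theory.

Local Open Scope ring_scope.
Local Open Scope quotient_scope.

Section Submodules.
Variables (R : nzRingType) (M N : lmodType R).

Definition submod (U : submodClosed M) : Type := {x : M | x \in U}.

HB.instance Definition _ (U : submodClosed M) :=
  SubChoice.copy (submod U) {x : M | x \in U}.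
HB.instance Definition _ (U : submodClosed M) :=
  [SubChoice_isSubLmodule of submod U by <:].

Definition submod_val (U : submodClosed M) (x : submod U) : M := val x.

Lemma submod_val_linear U : linear (@submod_val U).
Proof. exact: (linearP (\val : {linear submod U -> M})). Qed.

HB.instance Definition _ U := GRing.isLinear.Build R (submod U) M _
  (@submod_val U) (@submod_val_linear U).

Lemma submod_val_inj U : injective (@submod_val U).
Proof. exact: val_inj. Qed.

Definition span (S : set M) : {pred M} :=
  fun x => `[< forall U : submodClosed M,
                 (forall y, S y -> y \in U) -> x \in U >].

Lemma span_closed S : submod_closed (span S).
Proof.
split=> [|a x y /asboolP Ux /asboolP Uy]; apply/asboolP => U SU.
  exact: rpred0.
by rewrite rpredD ?rpredZ ?Ux ?Uy.
Qed.

HB.instance Definition _ S := GRing.isSubmodClosed.Build R M (span S)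
  (span_closed S).

Lemma mem_span (S : set M) x : S x -> x \in span S.
Proof. by move=> Sx; apply/asboolP => U; apply. Qed.

Lemma span_sub (S : set M) (U : submodClosed M) :
  (forall y, S y -> y \in U) -> {subset span S <= U}.
Proof. by move=> SU x /asboolP; apply. Qed.

Definition kerm (f : {linear M -> N}) : {pred M} := fun x => f x == 0.

Lemma kerm_closed f : submod_closed (kerm f).
Proof.
split=> [|a x y /eqP fx /eqP fy]; rewrite unfold_in /kerm ?linear0 //.
by rewrite linearP fx fy scaler0 addr0.
Qed.

HB.instance Definition _ f := GRing.isSubmodClosed.Build R M (kerm f)
  (kerm_closed f).

Definition imm (f : {linear M -> N}) : {pred N} :=
  fun y => `[< exists x, y = f x >].

Lemma imm_closed f : submod_closed (imm f).
Proof.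
split=> [|a _ _ /asboolP[x ->] /asboolP[y ->]]; apply/asboolP.
  by exists 0; rewrite linear0.
by exists (a *: x + y); rewrite linearP.
Qed.

HB.instance Definition _ f := GRing.isSubmodClosed.Build R N (imm f)
  (imm_closed f).

Definition addm (U W : submodClosed M) : {pred M} :=
  fun x => `[< exists u w, [/\ u \in U, w \in W & x = u + w] >].

Lemma addm_closed U W : submod_closed (addm U W).
Proof.
split=> [|a _ _ /asboolP[u [w [Uu Ww ->]]] /asboolP[u' [w' [Uu' Ww' ->]]]].
  by apply/asboolP; exists 0, 0; rewrite !rpred0 addr0.
apply/asboolP; exists (a *: u + u'), (a *: w + w').
by rewrite !rpredD ?rpredZ // scalerDr addrACA.
Qed.

HB.instance Definition _ U W := GRing.isSubmodClosed.Build R M (addm U W)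
  (addm_closed U W).

Lemma addm_subl (U W : submodClosed M) : {subset U <= addm U W}.
Proof. by move=> x Ux; apply/asboolP; exists x, 0; rewrite rpred0 addr0. Qed.

Lemma addm_subr (U W : submodClosed M) : {subset W <= addm U W}.
Proof. by move=> x Wx; apply/asboolP; exists 0, x; rewrite rpred0 add0r. Qed.

Section Inclusion.
Variables (U W : submodClosed M) (sUW : {subset U <= W}).

Definition incl (x : submod U) : submod W :=
  Sub (submod_val x) (sUW (valP x)).

Lemma incl_linear : linear incl.
Proof.
move=> a x y; apply: submod_val_inj; rewrite linearP.
by rewrite -[LHS]/(submod_val (a *: x + y)) linearP.
Qed.

HB.instance Definition _ := GRing.isLinear.Build R (submod U) (submod W) _
  incl incl_linear.
End Inclusion.
End Submodules.

Section QuotientModule.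
Variables (R : nzRingType) (M : lmodType R) (U : submodClosed M).

(* [GRing.SubmodClosed] does not record closure under opposites, which the
   quotients of [ring_quotient] need. *)
Definition zsubmod : {pred M} := U.

Lemma zsubmod_closed : zmod_closed zsubmod.
Proof.
split=> [|x y Ux Uy]; first exact: (rpred0 U).
by rewrite -scaleN1r; apply: (rpredD (S := U)) => //; apply: rpredZ.
Qed.

HB.instance Definition _ := GRing.isZmodClosed.Build M zsubmod zsubmod_closed.

Definition quotm : Type := Quotient.quot zsubmod.

HB.instance Definition _ := GRing.Zmodule.on quotm.

Definition quotm_pi (x : M) : quotm := \pi_(Quotient.quot zsubmod) x.

Definition quotm_scale (a : R) (x : quotm) : quotm :=
  quotm_pi (a *: repr (x : Quotient.quot zsubmod)).

Lemma quotm_pi_eq x y : quotm_pi x = quotm_pi y <-> x - y \in U.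
Proof.
rewrite /quotm_pi; split=> [/eqP|Uxy]; last apply/eqP;
  by rewrite -Quotient.idealrBE.
Qed.

Lemma quotm_ind (P : quotm -> Prop) : (forall x, P (quotm_pi x)) -> forall x, P x.
Proof. by move=> Ppi x; rewrite -[x](reprK (x : Quotient.quot zsubmod)); apply: Ppi. Qed.

Lemma quotm_pi_zmod : zmod_morphism quotm_pi.
Proof. by move=> x y; rewrite /quotm_pi !raddfB. Qed.

HB.instance Definition _ := GRing.isZmodMorphism.Build M quotm quotm_pi
  quotm_pi_zmod.

Lemma quotm_pi_scale a x : quotm_scale a (quotm_pi x) = quotm_pi (a *: x).
Proof.
apply/quotm_pi_eq; rewrite -scalerBr rpredZ //.
by apply/quotm_pi_eq; rewrite /quotm_pi reprK.
Qed.

Fact quotm_scaleA a b x :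
  quotm_scale a (quotm_scale b x) = quotm_scale (a * b) x.
Proof. by elim/quotm_ind: x => x; rewrite !quotm_pi_scale scalerA. Qed.

Fact quotm_scale1 : left_id 1 quotm_scale.
Proof. by elim/quotm_ind => x; rewrite quotm_pi_scale scale1r. Qed.

Fact quotm_scaleDr : right_distributive quotm_scale +%R.
Proof.
move=> a; elim/quotm_ind => x; elim/quotm_ind => y.
by rewrite -raddfD !quotm_pi_scale scalerDr raddfD.
Qed.

Fact quotm_scaleDl x : {morph quotm_scale^~ x : a b / a + b}.
Proof.
by move=> a b; elim/quotm_ind: x => x; rewrite !quotm_pi_scale scalerDl raddfD.
Qed.

HB.instance Definition _ := GRing.Zmodule_isLmodule.Build R quotm
  quotm_scaleA quotm_scale1 quotm_scaleDr quotm_scaleDl.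

Lemma quotm_pi_scalable : scalable quotm_pi.
Proof. by move=> a x; rewrite -quotm_pi_scale. Qed.

HB.instance Definition _ := GRing.isScalable.Build R M quotm _ quotm_pi
  quotm_pi_scalable.

Section Lift.
Variables (N : lmodType R) (f : {linear M -> N}).

Definition quotm_lift (_ : {subset U <= kerm f}) (x : quotm) : N :=
  f (repr (x : Quotient.quot zsubmod)).

Variable kerf : {subset U <= kerm f}.

Lemma quotm_liftE x : quotm_lift kerf (quotm_pi x) = f x.
Proof.
apply/eqP; rewrite -subr_eq0 -raddfB; apply: kerf.
by apply/quotm_pi_eq; rewrite /quotm_pi reprK.
Qed.

Lemma quotm_lift_linear : linear (quotm_lift kerf).
Proof.
move=> a; elim/quotm_ind => x; elim/quotm_ind => y.
by rewrite -linearP !quotm_liftE linearP.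
Qed.

HB.instance Definition _ := GRing.isLinear.Build R quotm N _ (quotm_lift kerf)
  quotm_lift_linear.
End Lift.
End QuotientModule.

Arguments quotm_pi {R M} U x.

Section Presented.
Variables (R : nzRingType) (G : choiceType) (rels : set {freeg G / R}).

Definition presented : Type := quotm (span rels).

HB.instance Definition _ := GRing.Lmodule.on presented.

Definition pgen (x : G) : presented := quotm_pi (span rels) << x >>.

Section Lift.
Variables (N : lmodType R) (h : G -> N).

Lemma fglift_linear : linear (fglift h : {freeg G / R} -> N).
Proof.
move=> a D E; rewrite -[D]Freeg_enum -[E]Freeg_enum.
move: (fgenum D) (fgenum E) => {D E} s t.
have -> : a *: [freeg s] = [freeg [seq (a * x.1, x.2) | x <- s]] :> {freeg G / R}.
  apply/eqP/freeg_eqP => k; rewrite coeffZ !coeff_Freeg /precoeff big_map.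
  by rewrite mulr_sumr.
rewrite -freeg_cat !fglift_Freeg prelift_cat /prelift big_map scaler_sumr.
by congr (_ + _); apply: eq_bigr => x _; rewrite scalerA.
Qed.

HB.instance Definition _ := GRing.isLinear.Build R {freeg G / R} N _
  (fglift h : {freeg G / R} -> N) fglift_linear.

Hypothesis h_rels : forall x, rels x -> fglift h x = 0.

Lemma presented_liftP :
  {subset span rels <= kerm (fglift h : {freeg G / R} -> N)}.
Proof. by apply: span_sub => x /h_rels hx; apply/eqP. Qed.

Definition presented_lift : presented -> N := quotm_lift presented_liftP.

HB.instance Definition _ := GRing.Linear.on presented_lift.

Lemma presented_liftE x : presented_lift (pgen x) = h x.
Proof. by rewrite [LHS]quotm_liftE /= liftU scale1r. Qed.
End Lift.
End Presented.

Section Restriction.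
Variables (R S : nzRingType) (f : {rmorphism R -> S}) (V : lmodType S).

Definition restr (_ : {rmorphism R -> S}) : Type := V.

HB.instance Definition _ := GRing.Zmodule.on (restr f).

Definition restr_scale (a : R) (x : restr f) : restr f := f a *: (x : V).

Fact restr_scaleA a b x : restr_scale a (restr_scale b x) = restr_scale (a * b) x.
Proof. by rewrite /restr_scale scalerA rmorphM. Qed.

Fact restr_scale1 : left_id 1 restr_scale.
Proof. by move=> x; rewrite /restr_scale rmorph1 scale1r. Qed.

Fact restr_scaleDr : right_distributive restr_scale +%R.
Proof. by move=> a x y; rewrite /restr_scale scalerDr. Qed.

Fact restr_scaleDl x : {morph restr_scale^~ x : a b / a + b}.
Proof. by move=> a b; rewrite /restr_scale rmorphD scalerDl. Qed.

HB.instance Definition _ := GRing.Zmodule_isLmodule.Build R (restr f)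
  restr_scaleA restr_scale1 restr_scaleDr restr_scaleDl.

Lemma restr_scaleE a (x : restr f) : a *: x = f a *: (x : V).
Proof. by []. Qed.
End Restriction.

Arguments restr {R S} V f.

Section BaseChange.
Variables (R : nzRingType) (S : comNzRingType) (f : {rmorphism R -> S}).
Variable M : lmodType R.

(* The [S]-module [M \otimes_R S]: the last relation says that [S] acts through
   the second factor. *)
Inductive tensor_rel : {freeg (M * S)%type / S} -> Prop :=
| TensorDl m m' s :
    tensor_rel (<< (m + m', s) >> - << (m, s) >> - << (m', s) >>)
| TensorDr m s s' :
    tensor_rel (<< (m, s + s') >> - << (m, s) >> - << (m, s') >>)
| TensorZ a m s :
    tensor_rel (<< (a *: m, s) >> - << (m, f a * s) >>)
| TensorM t m s :
    tensor_rel (<< (m, t * s) >> - t *: << (m, s) >>).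

Definition base_change : Type := presented tensor_rel.

HB.instance Definition _ := GRing.Lmodule.on base_change.

Definition tensor (m : M) (s : S) : base_change := pgen tensor_rel (m, s).

Section Lift.
Variables (V : lmodType S) (g : {linear M -> restr V f}).

Let h (x : M * S) : V := x.2 *: (g x.1 : V).

Lemma base_change_liftP x : tensor_rel x -> fglift h x = 0.
Proof.
pose F := (fglift h : {linear {freeg (M * S)%type / S} -> V}).
have FE y : fglift h << y >> = h y by rewrite liftU scale1r.
case=> [m m' s|m s s'|a m s|t m s]; rewrite -/(F _) !raddfB /= ?linearZ /= !FE.
- by rewrite /h /= raddfD scalerDr addrAC addrK subrr.
- by rewrite /h /= scalerDl addrAC addrK subrr.
- have gZ : (g (a *: m) : V) = f a *: (g m : V) by exact: (linearZ_LR g).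
  by rewrite /h /= gZ scalerA mulrC subrr.
- by rewrite /h /= scalerN scalerA subrr.
Qed.

Definition base_change_lift : base_change -> V :=
  presented_lift base_change_liftP.

HB.instance Definition _ := GRing.Linear.on base_change_lift.

Lemma base_change_liftE m s :
  base_change_lift (tensor m s) = s *: (g m : V).
Proof. exact: presented_liftE. Qed.
End Lift.
End BaseChange.

Section Kaehler.
Variables (B : comNzRingType) (A : {pred B}).

(* For a subring [A], [A]-linearity of [d] amounts to [d A = 0] together with
   additivity and the Leibniz rule. *)
Inductive kaehler_rel : {freeg B / B} -> Prop :=
| KaehlerC a of a \in A : kaehler_rel << a >>
| KaehlerD b c : kaehler_rel (<< b + c >> - << b >> - << c >>)
| KaehlerM b c : kaehler_rel (<< b * c >> - b *: << c >> - c *: << b >>).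

Definition kaehler : Type := presented kaehler_rel.

HB.instance Definition _ := GRing.Lmodule.on kaehler.

Definition kd (b : B) : kaehler := pgen kaehler_rel b.

Lemma kd_const a : a \in A -> kd a = 0.
Proof.
move=> Aa; rewrite /kd /pgen -[RHS](raddf0 (quotm_pi (span kaehler_rel))).
by apply/quotm_pi_eq; rewrite subr0; apply/mem_span/KaehlerC.
Qed.

Lemma kdD b c : kd (b + c) = kd b + kd c.
Proof.
rewrite /kd /pgen -raddfD; apply/quotm_pi_eq; rewrite opprD addrA.
exact/mem_span/KaehlerD.
Qed.

Lemma kdM b c : kd (b * c) = b *: kd c + c *: kd b.
Proof.
rewrite /kd /pgen -!linearZ -raddfD; apply/quotm_pi_eq; rewrite opprD addrA.
exact/mem_span/KaehlerM.
Qed.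
End Kaehler.

Record valuation (F : realType) (K : fieldType) := Valuation {
  absv :> K -> F;
  absv_ge0 : forall x, 0 <= absv x;
  absv_eq0 : forall x, absv x = 0 <-> x = 0;
  absvM : forall x y, absv (x * y) = absv x * absv y;
  absvD : forall x y, absv (x + y) <= Num.max (absv x) (absv y)
}.

Section RealValuedField.
Variables (F : realType) (K : fieldType) (v : valuation F K).

Lemma absv0 : v 0 = 0. Proof. exact/absv_eq0. Qed.

Lemma absv1 : v 1 = 1.
Proof.
have v1 : v 1 != 0 by apply/eqP => /absv_eq0/eqP; rewrite oner_eq0.
by apply: (mulfI v1); rewrite -absvM !mulr1.
Qed.

Lemma absvN x : v (- x) = v x.
Proof.
have vN1 : v (-1) = 1.
  apply/eqP; rewrite -(@eqrXn2 _ 2) ?ler01 ?absv_ge0 //.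
  by rewrite expr2 -absvM mulrNN mulr1 absv1 expr1n.
by rewrite -mulN1r absvM vN1 mul1r.
Qed.

Definition integers : {pred K} := fun x => v x <= 1.

Lemma integers_closed : subring_closed integers.
Proof.
split=> [|x y vx vy|x y vx vy]; rewrite unfold_in /integers ?absv1 //.
  by apply: le_trans (absvD _ _ _) _; rewrite absvN ge_max; apply/andP.
by rewrite absvM; apply: mulr_ile1; rewrite ?absv_ge0.
Qed.

HB.instance Definition _ := GRing.isSubringClosed.Build K integers
  integers_closed.

Definition intring : Type := {x : K | x \in integers}.

HB.instance Definition _ := SubChoice.copy intring {x : K | x \in integers}.
HB.instance Definition _ := [SubChoice_isSubComNzRing of intring by <:].

Definition intval : {rmorphism intring -> K} := \val.

Lemma intval_inj : injective intval. Proof. exact: val_inj. Qed.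

(* The multiplicative group of [K], written additively. *)
Definition mulgrp : Type := {x : K | x != 0}.

HB.instance Definition _ := SubChoice.copy mulgrp {x : K | x != 0}.

Definition mulgrp_mul (x y : mulgrp) : mulgrp :=
  Sub (val x * val y) (mulf_neq0 (valP x) (valP y)).

Definition mulgrp_one : mulgrp := Sub 1 (oner_neq0 K).

Lemma mulgrp_inv_subproof (x : mulgrp) : (val x)^-1 != 0.
Proof. by rewrite invr_eq0 (valP x). Qed.

Definition mulgrp_inv (x : mulgrp) : mulgrp :=
  Sub (val x)^-1 (mulgrp_inv_subproof x).

Fact mulgrp_mulA : associative mulgrp_mul.
Proof. by move=> x y z; apply: val_inj; rewrite /= mulrA. Qed.

Fact mulgrp_mulC : commutative mulgrp_mul.
Proof. by move=> x y; apply: val_inj; rewrite /= mulrC. Qed.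

Fact mulgrp_mul1 : left_id mulgrp_one mulgrp_mul.
Proof. by move=> x; apply: val_inj; rewrite /= mul1r. Qed.

Fact mulgrp_mulV : left_inverse mulgrp_one mulgrp_inv mulgrp_mul.
Proof. by move=> x; apply: val_inj; rewrite /= mulVf ?(valP x). Qed.

HB.instance Definition _ := GRing.isZmodule.Build mulgrp
  mulgrp_mulA mulgrp_mulC mulgrp_mul1 mulgrp_mulV.

Definition torsion (M : lmodType intring) : {pred M} :=
  fun x => `[< exists2 a : intring, a != 0 & a *: x = 0 >].

Lemma torsion_closed M : submod_closed (@torsion M).
Proof.
split=> [|a x y /asboolP[b b0 bx] /asboolP[c c0 cy]]; apply/asboolP.
  by exists 1; rewrite ?oner_eq0 ?scaler0.
exists (b * c); last first.
  have -> : (b * c) *: (a *: x + y) = (c * a) *: (b *: x) + b *: (c *: y).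
    by rewrite scalerDr !scalerA -mulrA [b * (c * a)]mulrC.
  by rewrite bx cy !scaler0 addr0.
have val0 (z : intring) : (z == 0) = (intval z == 0).
  by rewrite -(inj_eq intval_inj) rmorph0.
by move: b0 c0; rewrite !val0 rmorphM mulf_eq0 => /negPf-> /negPf->.
Qed.

HB.instance Definition _ M := GRing.isSubmodClosed.Build intring M
  (@torsion M) (@torsion_closed M).

Definition almost_zero (M : lmodType intring) : Prop :=
  forall (x : M) (r : F), r < 1 ->
    exists2 p : intring, r < v (intval p) & p *: x = 0.

Definition almost_iso (M N : lmodType intring) (f : {linear M -> N}) : Prop :=
  almost_zero (submod (kerm f)) /\ almost_zero (quotm (imm f)).

Definition almost_iso_submod (M : lmodType intring) (U W : submodClosed M) :
    Prop :=
  almost_iso (incl (@addm_subl _ _ U W)) /\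
  almost_iso (incl (@addm_subr _ _ U W)).

Section VectorSpace.
Variable V : lmodType K.

(* Bijectivity of the canonical map [U \otimes_{K°} K -> V], [u \otimes s |-> s u]. *)
Definition semilattice (U : submodClosed (restr V intval)) : Prop :=
  bijective (base_change_lift (@submod_val _ _ U)).

Record seminorm := Seminorm {
  snorm :> V -> F;
  snorm_ge0 : forall x, 0 <= snorm x;
  snorm0 : snorm 0 = 0;
  snormB : forall x y, snorm (x - y) <= Num.max (snorm x) (snorm y);
  snormZ : forall a x, snorm (a *: x) <= v a * snorm x
}.

Definition unit_ball (p : seminorm) : {pred restr V intval} :=
  fun x => p x <= 1.

Lemma unit_ball_closed p : submod_closed (unit_ball p).
Proof.
split=> [|a x y px py]; first by rewrite unfold_in /unit_ball snorm0 ler01.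
have pax : p (intval a *: (x : V)) <= 1.
  apply: le_trans (snormZ p _ _) _.
  by apply: mulr_ile1; rewrite ?absv_ge0 ?snorm_ge0 //; apply: (valP a).
have pNy : p (- (y : V)) <= 1.
  rewrite -sub0r; apply: le_trans (snormB p _ _) _.
  by rewrite snorm0 ge_max ler01.
rewrite unfold_in /unit_ball -[y]opprK restr_scaleE.
by apply: le_trans (snormB p _ _) _; rewrite ge_max pax.
Qed.

HB.instance Definition _ p := GRing.isSubmodClosed.Build intring
  (restr V intval) (unit_ball p) (unit_ball_closed p).

Definition almost_unit_ball (U : submodClosed (restr V intval)) (p : seminorm) :
    Prop :=
  almost_iso_submod U (unit_ball p).
End VectorSpace.

Section KaehlerSeminorm.
Variable A : {pred K}.

(* The empty representation of [0] contributes the value [0]. *)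
Definition kaehler_reps (x : kaehler A) : set F :=
  [set r | exists s : seq (K * K),
     x = \sum_(p <- s) p.1 *: kd A p.2 /\
     r = \big[Num.max/0]_(p <- s) (v p.1 * v p.2)].

Definition kaehler_norm (x : kaehler A) : F := inf (kaehler_reps x).

Lemma kaehler_span x : exists s : seq (K * K), x = \sum_(p <- s) p.1 *: kd A p.2.
Proof.
elim/quotm_ind: x => D; exists [seq (coeff z D, z) | z <- dom D].
rewrite big_map -{1}[D]freeg_sumE raddf_sum /=; apply: eq_bigr => z _.
rewrite /kd /pgen -linearZ; congr quotm_pi.
by apply/eqP/freeg_eqP => y; rewrite coeffZ !coeffU mul1r.
Qed.

Lemma kaehler_reps_ge0 x r : kaehler_reps x r -> 0 <= r.
Proof. by case=> s [_ ->]; apply: bigmax_ge_id. Qed.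

Lemma kaehler_reps_neq0 x : (kaehler_reps x !=set0)%classic.
Proof. by have [s xs] := kaehler_span x; eexists; exists s. Qed.

Lemma kaehler_reps_lb x : has_lbound (kaehler_reps x).
Proof. by exists 0 => r; apply: kaehler_reps_ge0. Qed.

Lemma kaehler_norm_ge0 x : 0 <= kaehler_norm x.
Proof.
by apply: lb_le_inf => [|r]; [apply: kaehler_reps_neq0|apply: kaehler_reps_ge0].
Qed.

Lemma kaehler_norm_le s (b : F) : 0 <= b ->
  (forall p, p \in s -> v p.1 * v p.2 <= b) ->
  kaehler_norm (\sum_(p <- s) p.1 *: kd A p.2) <= b.
Proof.
move=> b0 sb; apply: le_trans (_ : \big[Num.max/0]_(p <- s) (v p.1 * v p.2) <= b).
  by apply: ge_inf; [apply: kaehler_reps_lb|exists s].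
by rewrite big_seq; apply: bigmax_le.
Qed.

Lemma kaehler_norm_approx x (e : F) : 0 < e -> exists s : seq (K * K),
  x = \sum_(p <- s) p.1 *: kd A p.2 /\
  forall p, p \in s -> v p.1 * v p.2 <= kaehler_norm x + e.
Proof.
move=> e0; have [r [s [xs rs]] rx] := inf_adherent e0
  (conj (kaehler_reps_neq0 x) (kaehler_reps_lb x)).
exists s; split=> // p ps; apply: le_trans (ltW rx); rewrite rs.
exact: (@le_bigmax_seq _ _ _ s 0 p xpredT (fun p : K * K => v p.1 * v p.2)).
Qed.

Lemma kaehler_norm0 : kaehler_norm 0 = 0.
Proof.
apply/eqP; rewrite eq_le kaehler_norm_ge0 andbT.
by have := @kaehler_norm_le [::] 0 (lexx _) (fun p => ltac:(by [])); rewrite big_nil.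
Qed.

Lemma kaehler_normB x y :
  kaehler_norm (x - y) <= Num.max (kaehler_norm x) (kaehler_norm y).
Proof.
apply/ler_addgt0Pr => e e0.
have [s [xs sx]] := kaehler_norm_approx x e0.
have [t [yt ty]] := kaehler_norm_approx y e0.
have -> : x - y = \sum_(p <- s ++ [seq (- p.1, p.2) | p <- t]) p.1 *: kd A p.2.
  rewrite big_cat big_map {1}xs {1}yt -sumrN /=; congr (_ + _).
  by apply: eq_bigr => p _; rewrite scaleNr.
apply: kaehler_norm_le => [|p].
  by rewrite addr_ge0 ?(ltW e0) // le_max kaehler_norm_ge0.
rewrite mem_cat => /orP[/sx ps|/mapP[q /ty qt ->] /=].
  by apply: le_trans ps _; rewrite lerD2r le_max lexx.
by rewrite absvN; apply: le_trans qt _; rewrite lerD2r le_max lexx orbT.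
Qed.

Lemma kaehler_normZ a x : kaehler_norm (a *: x) <= v a * kaehler_norm x.
Proof.
have [->|a0] := eqVneq a 0.
  by rewrite scale0r kaehler_norm0 mulr_ge0 ?absv_ge0 ?kaehler_norm_ge0.
have va0 : 0 < v a.
  rewrite lt_def absv_ge0 andbT; apply: contra a0 => /eqP va.
  exact/eqP/(absv_eq0 v).
apply/ler_addgt0Pr => e e0.
have [s [xs sx]] := kaehler_norm_approx x (divr_gt0 e0 va0).
have -> : a *: x = \sum_(p <- [seq (a * p.1, p.2) | p <- s]) p.1 *: kd A p.2.
  rewrite big_map {1}xs scaler_sumr; apply: eq_bigr => p _.
  by rewrite scalerA.
apply: kaehler_norm_le => [|_ /mapP[q /sx qs ->] /=].
  by rewrite addr_ge0 ?(ltW e0) // mulr_ge0 ?absv_ge0 ?kaehler_norm_ge0.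
rewrite absvM -mulrA; apply: le_trans (ler_wpM2l (absv_ge0 _ _) qs) _.
by rewrite mulrDr mulrCA divff ?gt_eqF // mulr1.
Qed.

Definition kaehler_seminorm : seminorm (kaehler A) :=
  Seminorm kaehler_norm_ge0 kaehler_norm0 kaehler_normB kaehler_normZ.
End KaehlerSeminorm.

Section LogDifferentials.
Variable A : {pred K}.

(* [A°] as a subset of [K°]. *)
Definition Aint : {pred intring} := fun a => intval a \in A.

(* [Ω_{K°/A°} ⊕ (K° ⊗_Z Kˣ)] *)
Definition log_pre : Type :=
  (kaehler Aint * base_change (intmul 1 : {rmorphism int -> intring})
                              (zmodule mulgrp))%type.

HB.instance Definition _ := GRing.Lmodule.on log_pre.

(* [r ⊗ a] *)
Definition ktens (r : intring) (a : mulgrp) :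
    base_change (intmul 1 : {rmorphism int -> intring}) (zmodule mulgrp) :=
  tensor _ (a : zmodule mulgrp) r.

Inductive log_rel : log_pre -> Prop :=
| LogC (a : intring) (a0 : intval a != 0) of a \in Aint :
    log_rel (0, ktens 1 (Sub (intval a) a0))
| LogD (b : intring) (b0 : intval b != 0) :
    log_rel (kd Aint b, - ktens b (Sub (intval b) b0)).

Definition log_kaehler : Type := quotm (span log_rel).

HB.instance Definition _ := GRing.Lmodule.on log_kaehler.

Definition logd (b : intring) : log_kaehler :=
  quotm_pi (span log_rel) (kd Aint b, 0).

Definition delta (a : mulgrp) : log_kaehler :=
  quotm_pi (span log_rel) (0, ktens 1 a).

Local Notation Omega := (restr (kaehler A) intval).

Definition loc_d (b : intring) : Omega := kd A (intval b).

Lemma loc_dP x : kaehler_rel Aint x -> fglift loc_d x = 0.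
Proof.
pose G := (fglift loc_d : {linear {freeg intring / intring} -> Omega}).
have GE y : fglift loc_d << y >> = loc_d y by rewrite liftU scale1r.
have GZ b y : fglift loc_d (b *: y) = b *: fglift loc_d y.
  exact: (linearZ_LR G).
case=> [a Aa|b c|b c].
- by rewrite GE; apply: kd_const.
- rewrite -/(G _) !raddfB /= !GE /loc_d rmorphD kdD.
  by rewrite addrAC addrK subrr.
- rewrite -/(G _) !raddfB /= !GZ !GE /loc_d rmorphM kdM.
  by rewrite !restr_scaleE addrAC addrK subrr.
Qed.

Definition loc_kaehler : {linear kaehler Aint -> Omega} :=
  presented_lift loc_dP.

Definition dlog (a : mulgrp) : kaehler A := (val a)^-1 *: kd A (val a).

Lemma dlogD a b : dlog (a + b) = dlog a + dlog b.
Proof.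
case: a b => [a a0] [b b0]; rewrite /dlog /= kdM invfM scalerDr !scalerA.
by rewrite mulrAC mulVf // mul1r -mulrA mulVf // mulr1 addrC.
Qed.

Lemma dlogMz a n : dlog (a *~ n) = dlog a *~ n.
Proof.
have dlogB : zmod_morphism dlog.
  by move=> x y; apply: (addIr (dlog y)); rewrite -dlogD !subrK.
pose g := HB.pack_for {additive mulgrp -> kaehler A} dlog
  (GRing.isZmodMorphism.Build _ _ dlog dlogB).
exact: (raddfMz g n a).
Qed.

Definition loc_ktens (x : zmodule mulgrp * intring) : Omega :=
  intval x.2 *: dlog x.1.

Lemma loc_ktensP x :
  tensor_rel (intmul 1 : {rmorphism int -> intring}) x -> fglift loc_ktens x = 0.
Proof.
pose G := (fglift loc_ktens : {linear {freeg _ / intring} -> Omega}).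
have GE y : fglift loc_ktens << y >> = loc_ktens y by rewrite liftU scale1r.
have GZ b y : fglift loc_ktens (b *: y) = b *: fglift loc_ktens y.
  exact: (linearZ_LR G).
case=> [a b r|a r s|n a r|r a s]; rewrite -/(G _) !raddfB /= ?GZ !GE.
- have -> : loc_ktens (a + b, r) = loc_ktens (a, r) + loc_ktens (b, r).
    by rewrite /loc_ktens /= dlogD scalerDr.
  by rewrite addrAC addrK subrr.
- have -> : loc_ktens (a, r + s) = loc_ktens (a, r) + loc_ktens (a, s).
    by rewrite /loc_ktens /= scalerDl.
  by rewrite addrAC addrK subrr.
- apply/eqP; rewrite subr_eq0; apply/eqP; rewrite /loc_ktens.
  rewrite -[(n *: a, r).1]/((a : mulgrp) *~ n) dlogMz rmorphM rmorph_int.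
  by rewrite mulrC -scalerA scaler_int.
- apply/eqP; rewrite subr_eq0; apply/eqP.
  rewrite -[LHS]/(intval (r * s) *: dlog a) rmorphM -scalerA.
  exact: erefl.
Qed.

Definition loc_dlog : {linear base_change (intmul 1 : {rmorphism int -> intring})
                                (zmodule mulgrp) -> Omega} :=
  presented_lift loc_ktensP.

Lemma loc_dlogE r a : loc_dlog (ktens r a) = intval r *: dlog a.
Proof. exact: (presented_liftE loc_ktensP). Qed.

Definition loc_pre (x : log_pre) : Omega := loc_kaehler x.1 + loc_dlog x.2.

Lemma loc_pre_linear : linear loc_pre.
Proof. by move=> r x y; rewrite /loc_pre /= !linearP scalerDr addrACA. Qed.

HB.instance Definition _ := GRing.isLinear.Build intring log_pre Omega _
  loc_pre loc_pre_linear.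

Lemma loc_preP : {subset span log_rel <= kerm loc_pre}.
Proof.
apply: span_sub => _ [a a0 Aa|b b0]; apply/eqP.
  rewrite -[LHS]/(loc_kaehler 0 + loc_dlog (ktens 1 _)).
  rewrite linear0 add0r loc_dlogE /dlog.
  have -> : kd A (val (Sub (intval a) a0 : mulgrp)) = 0 by exact: kd_const.
  by rewrite !scaler0.
rewrite -[LHS]/(loc_kaehler (kd Aint b) + loc_dlog (- ktens b _)).
have -> x : loc_dlog (- x) = - loc_dlog x by exact: (raddfN loc_dlog).
rewrite loc_dlogE [loc_kaehler _]presented_liftE /loc_d /dlog.
by rewrite scalerA divff // scale1r subrr.
Qed.

(* The localization map, [db |-> db] and [δa |-> a^-1 da]; see [loc_map_logd] and
   [loc_map_delta]. *)
Definition loc_map : {linear log_kaehler -> Omega} := quotm_lift loc_preP.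

(* [Ω^log_{K°/A°} ⊗_{K°} K -> Ω_{K/A}], [ω ⊗ s |-> s * loc_map ω]. *)
Definition loc_tensor :
    {linear base_change intval log_kaehler -> kaehler A} :=
  base_change_lift loc_map.

Lemma loc_map_logd b : loc_map (logd b) = kd A (intval b).
Proof.
rewrite [LHS]quotm_liftE -[LHS]/(loc_kaehler _ + loc_dlog 0).
rewrite linear0 addr0.
exact: presented_liftE.
Qed.

Lemma loc_map_delta a : loc_map (delta a) = (val a)^-1 *: kd A (val a).
Proof.
rewrite [LHS]quotm_liftE -[LHS]/(loc_kaehler 0 + loc_dlog _).
rewrite linear0 add0r loc_dlogE.
by rewrite rmorph1 scale1r.
Qed.

Lemma loc_map_torsion : {subset @torsion log_kaehler <= kerm loc_map}.
Proof.
move=> x /asboolP[a a0 ax]; apply/eqP.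
have := linearZ_LR loc_map a x; rewrite ax linear0 restr_scaleE => /esym/eqP.
rewrite scaler_eq0 => /orP[|/eqP->//].
by rewrite -(rmorph0 intval) (inj_eq intval_inj) (negPf a0).
Qed.

Definition log_tf : Type := quotm (@torsion log_kaehler).

HB.instance Definition _ := GRing.Lmodule.on log_tf.

Definition loc_tf : {linear log_tf -> Omega} := quotm_lift loc_map_torsion.

(* The image in [Ω_{K/A}] of the torsion-free quotient. *)
Definition log_lattice : {pred Omega} := imm loc_tf.

HB.instance Definition _ := GRing.SubmodClosed.on log_lattice.
End LogDifferentials.
End RealValuedField.

Arguments loc_map {F K} v A.
Arguments loc_tensor {F K} v A.
Arguments loc_tf {F K} v A.
Arguments log_lattice {F K} v A _.

(* Main.v *)
(* Everything rests on the elements δb = "db/b" with b in K^*, which generate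
   Ω^log over K° and whose images generate Ω_{K/A} over K.

   (i) The inverse of Ω^log ⊗ K -> Ω_{K/A} sends db to b δb. The Leibniz rule is
   immediate from δ(bc) = δb + δc; additivity holds for integral b and c, where
   b δb comes from db in Ω_{K°/A°}, and in general after multiplying b and c by
   a common s in K°. It kills A as soon as A lies in Frac(A°). The kernel of
   M -> M ⊗ K is the torsion of M.

   (ii) c db = (cb) δb, so a representation x = Σ c_i db_i with |c_i b_i| <= t
   bounds by t every seminorm which is at most 1 on the δb, and lies in the
   lattice if t <= 1. A bound 1 + e with e small becomes 1 after multiplication
   by an element of K° of absolute value close to 1. *)
Require Import Defs.
From HB Require Import structures.
From mathcomp Require Import all_boot all_order all_algebra.
From mathcomp Require Import boolp classical_sets reals.
From mathcomp Require Import lra.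
From mathcomp.multinomials Require Import freeg.

Set Implicit Arguments.
Unset Strict Implicit.
Unset Printing Implicit Defensive.

Import Order.TTheory GRing.Theory Num.Theory.

Local Open Scope ring_scope.

(** * Linear maps, presented modules and submodules *)

Lemma inj_surj_bijective (T U : Type) (f : T -> U) :
  injective f -> (forall y, exists x, f x = y) -> bijective f.
Proof.
move=> injf surjf; pose g y := projT1 (cid (surjf y)).
have gK : cancel g f by move=> y; exact: (projT2 (cid (surjf y))).
by exists g => // x; apply: injf; rewrite gK.
Qed.

Lemma linear_injP (R : nzRingType) (M N : lmodType R) (f : {linear M -> N}) :
  (forall x, f x = 0 -> x = 0) -> injective f.
Proof.
move=> kf x y fxy; apply/eqP; rewrite -subr_eq0; apply/eqP/kf.
by rewrite linearB fxy subrr.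
Qed.

Lemma presented_ind (R : nzRingType) (G : choiceType)
    (rels : set {freeg G / R}) (P : presented rels -> Prop) :
  P 0 -> (forall a g y, P y -> P (a *: pgen rels g + y)) -> forall x, P x.
Proof.
move=> P0 PD; elim/quotm_ind => D; rewrite -[D]Freeg_enum.
elim: (fgenum D) => [|[a g] s IHs]; first by rewrite freeg_nil raddf0.
rewrite -cat1s freeg_cat raddfD /=.
have -> : [freeg [:: (a, g)]] = a *: << g >> :> {freeg G / R}.
  by apply/eqP/freeg_eqP => y; rewrite coeffZ !coeffU mul1r.
by rewrite linearZ; apply: PD.
Qed.

Lemma presented_rel (R : nzRingType) (G : choiceType)
    (rels : set {freeg G / R}) x :
  rels x -> quotm_pi (Defs.span rels) x = 0.
Proof.
move=> rx; rewrite -[RHS](raddf0 (quotm_pi (Defs.span rels))).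
by apply/quotm_pi_eq; rewrite subr0; apply: mem_span.
Qed.

Lemma addm_absorb (R : nzRingType) (M : lmodType R) (U W : submodClosed M) :
  {subset U <= W} -> {subset addm U W <= W}.
Proof. by move=> UW _ /asboolP[u [w [/UW Wu Ww ->]]]; apply: rpredD. Qed.

Lemma incl_kerm0 (R : nzRingType) (M : lmodType R) (U W : submodClosed M) (sUW
  : {subset U <= W})
    (x : submod (kerm (incl sUW))) : x = 0.
Proof.
apply: val_inj => /=; apply: val_inj; apply/eqP.
by have /eqP/(congr1 (@submod_val _ _ W))/eqP := valP x.
Qed.

(** * Calculus of tensors in a base change *)

Section Tensor.
Variables (R : nzRingType) (S : comNzRingType) (f : {rmorphism R -> S}).
Variable M : lmodType R.
Implicit Types (m : M) (s : S).

Lemma tensorDl m m' s : tensor f (m + m') s = tensor f m s + tensor f m' s.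
Proof.
by apply/eqP; rewrite -subr_eq0 opprD addrA -!raddfB;
  apply/eqP/presented_rel/TensorDl.
Qed.

Lemma tensorZ a m s : tensor f (a *: m) s = tensor f m (f a * s).
Proof.
by apply/eqP; rewrite -subr_eq0 -!raddfB; apply/eqP/presented_rel/TensorZ.
Qed.

Lemma tensorM t m s : tensor f m (t * s) = t *: tensor f m s.
Proof.
apply/eqP; rewrite -subr_eq0 -linearZ -!raddfB; apply/eqP/presented_rel.
exact: TensorM.
Qed.

Lemma tensor0l s : tensor f (0 : M) s = 0.
Proof.
by apply: (addIr (tensor f (0 : M) s)); rewrite add0r -tensorDl addr0.
Qed.

Lemma base_change_ind (P : base_change f M -> Prop) :
  P 0 -> (forall m s y, P y -> P (tensor f m s + y)) -> forall x, P x.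
Proof.
move=> P0 PD; apply: presented_ind => // s [m t] y Py.
by rewrite -[pgen _ _]/(tensor f m t) -tensorM; apply: PD.
Qed.
End Tensor.

(** * Denominators and small scalars in a valued field *)

Section ValuedField.
Variables (F : realType) (K : fieldType) (v : valuation F K).
Local Notation Ko := (intring v).
Local Notation iv := (intval v).

Lemma intval_eq0 (a : Ko) : (iv a == 0) = (a == 0).
Proof. by rewrite -(inj_eq (@intval_inj _ _ v)) rmorph0. Qed.

Lemma intring_of (x : K) : v x <= 1 -> exists a : Ko, iv a = x.
Proof. by move=> vx; exists (Sub x vx : Ko). Qed.

Lemma absv_gt0 x : (0 < v x) = (x != 0).
Proof.
rewrite lt_def absv_ge0 andbT; congr negb.
by apply/eqP/eqP => [/absv_eq0//|->]; rewrite absv0.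
Qed.

Lemma absvV x : v x^-1 = (v x)^-1.
Proof.
have [->|x0] := eqVneq x 0; first by rewrite invr0 absv0 invr0.
have vx : v x != 0 by rewrite gt_eqF ?absv_gt0.
by apply: (mulfI vx); rewrite -absvM !divff // absv1.
Qed.

(** An element outside [K°] has its inverse in [K°]; [c] is the product of these inverses. *)
Lemma common_scale (s : seq K) :
  exists2 c : Ko, c != 0 & forall x, x \in s -> v (iv c * x) <= 1.
Proof.
elim: s => [|x s [c c0 cs]]; first by exists 1; rewrite ?oner_eq0.
have [vx|vx] := leP (v x) 1.
  exists c => // y; rewrite inE => /orP[/eqP->|/cs//].
  by rewrite absvM mulr_ile1 ?absv_ge0 //; apply: (valP c).
have x0 : x != 0 by rewrite -absv_gt0 (lt_trans ltr01).
have vx1 : v x^-1 <= 1 by rewrite absvV invf_le1 ?absv_gt0 // ltW.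
have [d dx] := intring_of vx1.
exists (c * d);
  first by rewrite -intval_eq0 rmorphM dx mulf_neq0 ?invr_eq0 // intval_eq0.
move=> y; rewrite inE rmorphM dx => /orP[/eqP->|/cs cy].
  by rewrite -mulrA mulVf // mulr1; apply: (valP c).
by rewrite mulrAC absvM mulr_ile1 ?absv_ge0.
Qed.

(** Every scalar is a quotient of elements of [K°], so finitely many tensors have a common
    denominator. *)
Lemma tensor_frac (M : lmodType Ko) (x : base_change iv M) :
  exists2 c : Ko, c != 0 & exists m, x = tensor iv m (iv c)^-1.
Proof.
elim/base_change_ind: x => [|m s y [c c0 [m' ->]]].
  by exists 1; rewrite ?oner_eq0 //; exists 0; rewrite tensor0l.
have [d d0 ds] := common_scale [:: s].
have [e es] := intring_of (ds s (mem_head _ _)).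
have c1 : iv c != 0 by rewrite intval_eq0.
have d1 : iv d != 0 by rewrite intval_eq0.
exists (c * d); first by rewrite -intval_eq0 rmorphM mulf_neq0.
exists ((c * e) *: m + d *: m'); rewrite tensorDl !tensorZ.
have -> : iv (c * e) / iv (c * d) = s.
  rewrite !rmorphM es.
  by rewrite invfM mulrACA divff // mul1r mulrAC divff // mul1r.
suff -> : iv d / iv (c * d) = (iv c)^-1 by [].
by rewrite rmorphM invfM mulrCA divff // mulr1.
Qed.

(* The bound is the absolute value of a non-zero element: when the valuation is
   trivial, a real bound below 1 would only leave c = 0. *)
Definition near0 (P : K -> Prop) : Prop :=
  exists2 e : K, e != 0 & forall c, v c <= v e -> P c.

Lemma near0_imp2 (P Q T : K -> Prop) :
  (forall c, P c -> Q c -> T c) -> near0 P -> near0 Q -> near0 T.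
Proof.
move=> PQT [d d0 Pd] [e e0 Qe]; have [de|ed] := leP (v d) (v e).
  by exists d => // c cd; apply: PQT; [apply: Pd|apply/Qe/(le_trans cd)].
by exists e => // c ce; apply: PQT; [apply/Pd/(le_trans ce)/ltW|apply: Qe].
Qed.

Lemma near0_imp (P Q : K -> Prop) :
  (forall c, P c -> Q c) -> near0 P -> near0 Q.
Proof. by move=> PQ [d d0 Pd]; exists d => // c /Pd/PQ. Qed.

Lemma near0_scale (P : K -> Prop) a : near0 P -> near0 (fun c => P (c * a)).
Proof.
(* The bound will be [d / a]; for [a = 0] any bound will do, as [c * a = 0]. *)
case=> d d0 Pd; have [->|a0] := eqVneq a 0.
  by exists 1; rewrite ?oner_eq0 // => c _; apply: Pd;
    rewrite mulr0 absv0 absv_ge0.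
exists (d / a); first by rewrite mulf_neq0 ?invr_eq0.
by move=> c; rewrite absvM absvV ler_pdivlMr ?absv_gt0 // -absvM; apply: Pd.
Qed.

Lemma near0_integral (s : seq K) :
  near0 (fun c => forall x, x \in s -> v (c * x) <= 1).
Proof.
have [c c0 cs] := common_scale s; exists (iv c); first by rewrite intval_eq0.
move=> d dc x /cs; apply: le_trans.
by rewrite !absvM ler_wpM2r ?absv_ge0.
Qed.

(** The identity of [K°] extended by the default value 0; it is additive and [K°]-linear at integral
    arguments. *)
Definition trunc (x : K) : Ko := insubd 0 x.

Lemma truncK x : v x <= 1 -> iv (trunc x) = x.
Proof. by move=> vx; rewrite /trunc; exact: (insubdK (0 : Ko)). Qed.

Lemma truncD x y : v x <= 1 -> v y <= 1 -> trunc (x + y) = trunc x + trunc y.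
Proof.
move=> vx vy; apply: intval_inj; rewrite rmorphD !truncK //.
by apply: le_trans (absvD _ _ _) _; rewrite ge_max vx.
Qed.

Lemma truncN x : v x <= 1 -> trunc (- x) = - trunc x.
Proof. by move=> vx; apply: intval_inj; rewrite rmorphN !truncK // absvN. Qed.

Lemma truncM a x : v x <= 1 -> trunc (iv a * x) = a * trunc x.
Proof.
move=> vx; apply: intval_inj; rewrite rmorphM !truncK //.
by rewrite absvM mulr_ile1 ?absv_ge0 //; apply: (valP a).
Qed.

Lemma trunc_int a : trunc (iv a) = a.
Proof. by apply: intval_inj; rewrite truncK //; apply: (valP a). Qed.

(** * The kernel of [M -> M ⊗ K] *)

Section TensorKernel.
Variable M : lmodType Ko.
Local Notation MK := {freeg (M * K)%type / K}.
Implicit Types (D E : MK) (g h : K -> M).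

(** Formally [c] times the class of [D], meaningful in [M] once all [c * (coeff z D * z.2)] are
    integral. The list [s] is free so that several [D] can share one. *)
Definition eval (s : seq (M * K)) (c : K) D : M :=
  \sum_(z <- s) trunc (c * (coeff z D * z.2)) *: z.1.

Lemma eval_dom s c D :
  uniq s -> {subset dom D <= s} -> eval (dom D) c D = eval s c D.
Proof.
move=> us sDs; rewrite /eval [RHS](bigID (mem (dom D))) /= [X in _ + X]big1.
  rewrite addr0 -[RHS]big_filter; apply: perm_big; apply: uniq_perm.
  - exact: uniq_dom.
  - exact: filter_uniq.
  by move=> z; rewrite mem_filter /=; case: (boolP (z \in _)) => // /sDs->.
move=> z /coeff_outdom->.
by rewrite mul0r mulr0 -(rmorph0 iv) trunc_int scale0r.
Qed.

(* The class of D in [M \otimes K], seen as the germ at 0 of the partial map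
   c |-> c D from K to M. *)
Definition germ D g : Prop := near0 (fun c => eval (dom D) c D = g c).

Lemma germ_eq D g h : germ D g -> near0 (fun c => g c = h c) -> germ D h.
Proof. by apply: near0_imp2 => c -> . Qed.

(** Scaling [D] by [a] rescales the argument [c]. For small [c] all scalars involved, listed in [t],
    become integral, and there [trunc] is additive. *)
Lemma germ_linear a D E g h : germ D g -> germ E h ->
  germ (a *: D + E) (fun c => g (c * a) + h c).
Proof.
move=> /(near0_scale a) Dg Eh.
pose s := undup (dom D ++ dom E ++ dom (a *: D + E)).
have us : uniq s by apply: undup_uniq.
have sub D' : D' \in [:: D; E; a *: D + E] -> {subset dom D' <= s}.
  move=> D'D z zD; rewrite mem_undup !mem_cat.
  by move: D'D zD; rewrite !inE => /or3P[]/eqP-> ->; rewrite ?orbT.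
pose t := [seq a * (coeff z D * z.2) | z <- s] ++
  [seq coeff z E * z.2 | z <- s].
apply: near0_imp2 (near0_integral t) (near0_imp2 (fun _ => @conj _ _) Dg Eh).
move=> c ct [<- <-].
rewrite !(eval_dom _ us (sub _ _)) ?inE ?eqxx ?orbT // /eval -big_split /=.
apply: eq_big_seq => z zs; rewrite -scalerDl coeffD coeffZ mulrDl mulrDr
  -!mulrA.
rewrite truncD //; apply: ct; rewrite mem_cat.
  by rewrite (map_f (fun z => a * (coeff z D * z.2))).
by rewrite (map_f (fun z => coeff z E * z.2)) ?orbT.
Qed.

Lemma germ0 : germ 0 (fun=> 0).
Proof.
by exists 1; rewrite ?oner_eq0 // => c _; rewrite /eval dom0 big_nil.
Qed.

Lemma germU m s : germ << (m, s) >> (fun c => trunc (c * s) *: m).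
Proof.
exists 1; rewrite ?oner_eq0 // => c _.
by rewrite /eval domU1 big_seq1 coeffU eqxx /= !mul1r.
Qed.

Lemma germB D E g h : germ D g -> germ E h ->
  germ (D - E) (fun c => g c + h (- c)).
Proof.
move=> Dg Eh; rewrite addrC -scaleN1r.
apply: germ_eq (germ_linear (-1) Eh Dg) _.
by exists 1; rewrite ?oner_eq0 // => c _; rewrite mulrN1 addrC.
Qed.

(** A [K]-subspace containing the tensor relations, hence their span: a test for elements that
    become 0 in the base change. *)
Definition vanishing : {pred MK} := fun D => `[< germ D (fun=> 0) >].

Lemma vanishing_closed : submod_closed vanishing.
Proof.
split=> [|a D E /asboolP D0 /asboolP E0]; apply/asboolP; first exact: germ0.
apply: germ_eq (germ_linear a D0 E0) _.
by exists 1; rewrite ?oner_eq0 // => c _; rewrite addr0.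
Qed.

HB.instance Definition _ := GRing.isSubmodClosed.Build K MK vanishing
  vanishing_closed.

(** For small [c] each relation turns into an identity in [M]. *)
Lemma tensor_rel_vanishing D : tensor_rel iv D -> D \in vanishing.
Proof.
case=> [m m' s|m s s'|a m s|t m s]; apply/asboolP.
- apply: germ_eq (germB (germB (germU _ _) (germU _ _)) (germU _ _)) _.
  apply: near0_imp (near0_integral [:: s]) => c /(_ s (mem_head _ _)) cs.
  by rewrite !mulNr truncN // !scaleNr scalerDr addrAC addrK subrr.
- apply: germ_eq (germB (germB (germU _ _) (germU _ _)) (germU _ _)) _.
  apply: near0_imp (near0_integral [:: s; s']) => c cs.
  have vs : v (c * s) <= 1 by rewrite cs ?inE ?eqxx.
  have vs' : v (c * s') <= 1 by rewrite cs ?inE ?eqxx ?orbT.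
  by rewrite mulrDr !mulNr !truncN // truncD // !scaleNr scalerDl addrAC addrK
    subrr.
- apply: germ_eq (germB (germU _ _) (germU _ _)) _.
  apply: near0_imp (near0_integral [:: s]) => c /(_ s (mem_head _ _)) cs.
  by rewrite mulrCA truncM ?mulNr ?absvN // truncN // mulrN scaleNr scalerA
    mulrC subrr.
- rewrite -scaleNr addrC.
  apply: germ_eq (germ_linear _ (germU _ _) (germU _ _)) _.
  apply: near0_imp (near0_integral [:: t * s]) => c /(_ _ (mem_head _ _)) cs.
  by rewrite mulrN mulNr -mulrA truncN // scaleNr addNr.
Qed.

(** If [m ⊗ 1 = 0], the germ [c |-> c m] vanishes, so a small non-zero element of [K°] kills [m]. *)
Lemma tensor1_eq0 (m : M) : tensor iv m 1 = 0 -> m \in @torsion _ _ v M.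
Proof.
rewrite /tensor /pgen -(raddf0 (quotm_pi _)) => /quotm_pi_eq; rewrite subr0.
move=> /(span_sub tensor_rel_vanishing)/asboolP.
move=> /(near0_imp2 (fun _ => @conj _ _) (germU m 1)) [e e0 He].
(* The bound [e] need not be integral; [d = c e] is, with [|d| <= |e|] because [|c| <= 1]. *)
have [c c0 ce] := common_scale [:: e].
have [d de] := intring_of (ce e (mem_head _ _)).
have [|He1 He2] := He (iv d).
  by rewrite de absvM ler_piMl ?absv_ge0 //; apply: (valP c).
apply/asboolP; exists d.
  by rewrite -intval_eq0 de mulf_neq0 ?intval_eq0.
by rewrite -{1}[d]trunc_int -[iv d]mulr1 -He1.
Qed.
End TensorKernel.

(** * Zero modules, and base change of embeddings *)

Lemma almost_zero_unit (M : lmodType Ko) : (forall x : M, x = 0) ->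
  @almost_zero _ _ v M.
Proof. by move=> M0 x r r1; exists 1; rewrite ?rmorph1 ?absv1. Qed.

(** Every element is some [m ⊗ 1/c], with image [g m / c]. *)
Lemma base_change_lift_inj (M : lmodType Ko) (V : lmodType K)
    (g : {linear M -> restr V iv}) :
  injective g -> injective (base_change_lift g).
Proof.
move=> injg; apply: linear_injP => x; have [c c0 [m ->]] := tensor_frac x.
move=> /(etrans (esym (base_change_liftE g m _)))/eqP;
  rewrite scaler_eq0 invr_eq0 intval_eq0 (negPf c0).
by move=> /eqP gm; rewrite (injg m 0) ?tensor0l // gm linear0.
Qed.

(** * Generators and relations of logarithmic differentials *)

Section Log.
Variable A : subringClosed K.
Local Notation Om := (kaehler A).
Local Notation OmLog := (log_kaehler v A).
Local Notation T := (base_change iv OmLog).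

Lemma kd0 : kd A 0 = 0.
Proof. by apply: (addIr (kd A 0)); rewrite -kdD !add0r. Qed.

Lemma kd_dlog (b : mulgrp K) : kd A (val b) = val b *: dlog A b.
Proof. by rewrite /dlog scalerA divff ?scale1r // (valP b). Qed.

Local Notation log_pi := (quotm_pi (Defs.span (@log_rel _ _ v A))).

Lemma log_pi_inl a x y :
  log_pi (a *: x + y, 0) = a *: log_pi (x, 0) + log_pi (y, 0).
Proof. by rewrite -(linearP log_pi); congr (log_pi (_, _));
  rewrite /= scaler0 addr0. Qed.

Lemma log_pi_inr a x y :
  log_pi (0, a *: x + y) = a *: log_pi (0, x) + log_pi (0, y).
Proof. by rewrite -(linearP log_pi); congr (log_pi (_, _));
  rewrite /= scaler0 addr0. Qed.

Lemma log_pi_pair x y : log_pi (x, y) = log_pi (x, 0) + log_pi (0, y).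
Proof. by rewrite -(raddfD log_pi); congr (log_pi (_, _));
  rewrite /= ?addr0 ?add0r. Qed.

Lemma log_pi0 : log_pi (0, 0) = 0.
Proof. exact: (raddf0 log_pi). Qed.

Lemma log_pi_rel x : log_rel x -> log_pi x = 0.
Proof. by move=> rx; rewrite -log_pi0; apply/quotm_pi_eq; rewrite subr0;
  apply: mem_span. Qed.

Lemma deltaD (a b : mulgrp K) : delta v A (a + b) = delta v A a + delta v A b.
Proof.
have kD : @ktens _ _ v 1 (a + b) = 1 *: ktens 1 a + ktens 1 b.
  by rewrite scale1r; apply: tensorDl.
by rewrite /delta kD log_pi_inr scale1r.
Qed.

Lemma delta_const (a : K) (a0 : a != 0) : a \in A -> v a <= 1 ->
  delta v A (Sub a a0) = 0.
Proof.
move=> Aa va; apply: log_pi_rel.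
exact: (@LogC _ _ v A (Sub a va : Ko) a0 Aa).
Qed.

Lemma ktensZ (r : Ko) a : ktens r a = r *: ktens 1 a.
Proof. by rewrite /ktens -tensorM mulr1. Qed.

Lemma logd_delta (b : Ko) (b0 : iv b != 0) :
  logd A b = b *: delta v A (Sub (iv b) b0).
Proof.
apply/eqP; rewrite -subr_eq0 -scaleNr -[_ *: _]addr0 -log_pi0 -log_pi_inr addr0.
by rewrite -log_pi_pair scaleNr -ktensZ log_pi0; apply/eqP/log_pi_rel/LogD.
Qed.

Lemma logdD (b c : Ko) : logd A (b + c) = logd A b + logd A c.
Proof. by rewrite /logd kdD -[kd _ b]scale1r log_pi_inl !scale1r. Qed.

Lemma logd0 : logd A (0 : Ko) = 0.
Proof. by apply: (addIr (logd A 0)); rewrite -logdD !add0r. Qed.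

(** Each [db] with [b] non-zero is [b δb] and [d0 = 0], so the [δa] suffice as generators. *)
Lemma log_kaehler_ind (P : OmLog -> Prop) :
  P 0 -> (forall (r : Ko) a y, P y -> P (r *: delta v A a + y)) ->
    forall x, P x.
Proof.
move=> P0 PD; elim/quotm_ind => -[x y]; rewrite log_pi_pair.
elim/presented_ind: x => [|r b x IHx].
  rewrite log_pi0 add0r.
  elim/base_change_ind: y => [|m s y IHy]; first by rewrite log_pi0.
  by rewrite -[tensor _ m s]/(ktens s m) ktensZ log_pi_inr; apply: PD.
rewrite log_pi_inl -addrA; have [->|b0] := eqVneq b 0.
  by rewrite -[log_pi (pgen _ _, 0)]/(logd A 0) logd0 scaler0 add0r.
have b1 : iv b != 0 by rewrite intval_eq0.
rewrite -[log_pi (pgen _ _, 0)]/(logd A b).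
by rewrite (logd_delta b1) scalerA; apply: PD.
Qed.

(** The formula [db = b δb] read as a definition; [δb] exists only for non-zero [b], and 0 is sent
    to 0. *)
Definition log_der (b : K) : T :=
  if insub b : option (mulgrp K) is Some b' then tensor iv (delta v A b') b
    else 0.

Lemma log_der0 : log_der 0 = 0.
Proof. by rewrite /log_der insubF // eqxx. Qed.

Lemma log_derE (b : mulgrp K) : log_der (val b) =
  tensor iv (delta v A b) (val b).
Proof. by rewrite /log_der valK. Qed.

Lemma log_derM b c : log_der (b * c) = b *: log_der c + c *: log_der b.
Proof.
have [->|b0] := eqVneq b 0;
  first by rewrite mul0r log_der0 scale0r scaler0 addr0.
have [->|c0] := eqVneq c 0;
  first by rewrite mulr0 log_der0 scale0r scaler0 addr0.
pose b' : mulgrp K := Sub b b0; pose c' : mulgrp K := Sub c c0.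
rewrite -[b * c]/(val (b' + c')) -[b]/(val b') -[c]/(val c') !log_derE.
by rewrite deltaD tensorDl addrC -!tensorM [val c' * _]mulrC.
Qed.

Lemma log_der_int (b : Ko) : log_der (iv b) = tensor iv (logd A b) 1.
Proof.
have [->|] := eqVneq b 0; first by rewrite rmorph0 log_der0 logd0 tensor0l.
rewrite -intval_eq0 => b0.
rewrite (logd_delta b0) tensorZ mulr1.
exact: (log_derE (Sub (iv b) b0)).
Qed.

Lemma log_derD b c : log_der (b + c) = log_der b + log_der c.
Proof.
have [s s0 sP] := common_scale [:: b; c].
have [x xb] : exists x, iv x = iv s * b by apply/intring_of/sP;
  rewrite !inE eqxx.
have [y yc] : exists y, iv y = iv s * c by apply/intring_of/sP;
  rewrite !inE eqxx orbT.
have : log_der (iv (x + y)) = log_der (iv x) + log_der (iv y).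
  by rewrite !log_der_int logdD tensorDl.
(* By Leibniz both sides contain [b + c] times the derivative of [s]; it cancels, and the rest is
   divided by [s]. *)
rewrite rmorphD xb yc -mulrDr !log_derM scalerDl addrACA => /addIr.
by rewrite -scalerDr; apply: scalerI; rewrite intval_eq0.
Qed.

Lemma loc_tensorE m s : loc_tensor v A (tensor iv m s) =
  s *: (loc_map v A m : Om).
Proof. exact: base_change_liftE. Qed.

(** * The inverse of the localization map *)

Section LogInverse.
Hypothesis A_frac : forall a : K, a \in A ->
  exists b c : K, [/\ b \in A, c \in A, v b <= 1 & v c <= 1] /\
    (c != 0) /\ a = b / c.

(** Integral constants have [δb = 0]; for [a = b / c] the Leibniz rule for [b = a c] leaves
    [0 = c * log_der a]. *)
Lemma log_der_const a : a \in A -> log_der a = 0.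
Proof.
have int_const b : b \in A -> v b <= 1 -> log_der b = 0.
  move=> Ab vb; have [->|b0] := eqVneq b 0; first exact: log_der0.
  by rewrite -[b]/(val (Sub b b0 : mulgrp K)) log_derE delta_const // tensor0l.
move=> /A_frac[b [c [[Ab Ac vb vc] [c0 ->]]]].
have := log_derM (b / c) c; rewrite divfK // (int_const b) // (int_const c) //
  scaler0 add0r.
by move=> /esym/eqP; rewrite scaler_eq0 (negPf c0) => /eqP.
Qed.

Lemma log_der_rel x : kaehler_rel A x -> fglift log_der x = 0.
Proof.
pose H := (fglift log_der : {linear {freeg K / K} -> T}).
have HE y : fglift log_der << y >> = log_der y by rewrite liftU scale1r.
have HZ b y : fglift log_der (b *: y) = b *: fglift log_der y.
  exact: (linearZ_LR H).
case=> [a Aa|b c|b c]; rewrite -?/(H _) ?raddfB /= ?HZ !HE.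
- exact: log_der_const.
- by rewrite log_derD addrAC addrK subrr.
- by rewrite log_derM addrAC addrK subrr.
Qed.

Lemma loc_tensor_bij : bijective (loc_tensor v A).
Proof.
pose H := presented_lift log_der_rel.
have HE b : H (kd A b) = log_der b by exact: presented_liftE.
have HZ a x : H (a *: x) = a *: H x by exact: (linearZ_LR H).
have HD x y : H (x + y) = H x + H y by exact: (raddfD H).
exists H => x.
  elim/base_change_ind: x => [|m s y IHy];
    first by rewrite raddf0 [LHS](raddf0 H).
  rewrite linearD HD IHy loc_tensorE HZ -{2}[s]mulr1 tensorM;
    congr (s *: _ + _).
  elim/log_kaehler_ind: m => [|r a m IHm].
    by rewrite raddf0 tensor0l [LHS](raddf0 H).
  rewrite linearP restr_scaleE HD HZ IHm tensorDl tensorZ; congr (_ + _).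
  (* [δa] goes to [a^-1 da], which returns as [a^-1 (δa ⊗ a) = δa ⊗ 1]. *)
  rewrite mulr1 loc_map_delta HZ HE log_derE -!tensorM.
  by rewrite mulVf ?mulr1 //; apply: (valP a).
elim/presented_ind: x => [|a b y IHy]; first by rewrite [H 0](raddf0 H) raddf0.
rewrite HD HZ linearP IHy; congr (a *: _ + _).
rewrite -[pgen _ _]/(kd A b) HE; have [->|b0] := eqVneq b 0.
  by rewrite log_der0 raddf0 kd0.
rewrite -[b]/(val (Sub b b0 : mulgrp K)) log_derE loc_tensorE loc_map_delta.
by rewrite -/(dlog _ _) -kd_dlog.
Qed.

(** If [m] dies in the differentials of [K], then [m ⊗ 1 = 0] by injectivity of [loc_tensor], so [m]
    is torsion. *)
Lemma injective_loc_tf : injective (loc_tf v A).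
Proof.
apply: linear_injP; elim/quotm_ind => m.
move=> /(etrans (esym (quotm_liftE (@loc_map_torsion _ _ v A) m))) lm0.
rewrite -[RHS](raddf0 (quotm_pi _)); apply/quotm_pi_eq; rewrite subr0.
apply: tensor1_eq0; apply: (bij_inj loc_tensor_bij).
by rewrite loc_tensorE scale1r raddf0.
Qed.
End LogInverse.

(** * The lattice and the Kähler seminorm *)

Lemma log_latticeP (x : restr Om iv) :
  reflect (exists m, x = loc_map v A m) (x \in log_lattice v A).
Proof.
apply: (iffP idP) => [/asboolP[y ->]|[m ->]].
  elim/quotm_ind: y => m; exists m; exact: quotm_liftE.
by apply/asboolP; exists (quotm_pi _ m); rewrite [RHS]quotm_liftE.
Qed.

Lemma dlog_lattice (a : mulgrp K) c : v c <= 1 ->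
  (c *: dlog A a : restr Om iv) \in log_lattice v A.
Proof.
move=> vc; apply/log_latticeP; exists ((Sub c vc : Ko) *: delta v A a).
by rewrite [RHS]linearZ_LR loc_map_delta.
Qed.

(** Surjectivity: [a db = (a b) dlog b], and [dlog b] lies in the lattice. *)
Lemma log_lattice_semilattice : semilattice (log_lattice v A).
Proof.
apply: inj_surj_bijective.
  by apply: base_change_lift_inj; apply: submod_val_inj.
elim/presented_ind => [|a b y [x <-]]; first by exists 0; rewrite linear0.
rewrite -[pgen _ _]/(kd A b); have [->|b0] := eqVneq b 0.
  by exists x; rewrite kd0 scaler0 add0r.
pose b' : mulgrp K := Sub b b0.
have ub : (dlog A b' : restr Om iv) \in log_lattice v A.
  by rewrite -[dlog _ _]scale1r dlog_lattice // absv1.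
exists (tensor iv (Sub (dlog A b' : restr Om iv) ub : submod (log_lattice v A))
  (a * b) + x).
rewrite linearD; congr (_ + _); rewrite [LHS]base_change_liftE.
by rewrite -scalerA; congr (_ *: _); rewrite -[b in RHS]/(val b') kd_dlog.
Qed.

(** [a^-1 da] is itself a one-term representation, of value [|a^-1| |a| = 1]. *)
Lemma log_lattice_unit_ball :
  {subset log_lattice v A <= unit_ball (kaehler_seminorm v A)}.
Proof.
move=> _ /log_latticeP[m ->]; elim/log_kaehler_ind: m => [|r a m IHm].
  by rewrite linear0; apply: rpred0.
rewrite linearP; apply: rpredD => //; apply: rpredZ; rewrite loc_map_delta.
have -> : (val a)^-1 *: kd A (val a) =
    \sum_(p <- [:: ((val a)^-1, val a)]) p.1 *: kd A p.2.
  by rewrite big_seq1.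
apply: kaehler_norm_le => // p; rewrite inE => /eqP-> /=.
by rewrite -absvM mulVf ?absv1 //; apply: (valP a).
Qed.

Lemma kd_lattice c b : v c * v b <= 1 ->
  (c *: kd A b : restr Om iv) \in log_lattice v A.
Proof.
have [->|b0] := eqVneq b 0; first by rewrite kd0 scaler0 => _; apply: rpred0.
rewrite -absvM -[b]/(val (Sub b b0 : mulgrp K)) kd_dlog scalerA.
exact: dlog_lattice.
Qed.

Lemma kaehler_seminorm_max (p : seminorm v Om) :
  {subset log_lattice v A <= unit_ball p} ->
  forall x, p x <= kaehler_seminorm v A x.
Proof.
move=> Lp x; apply/ler_addgt0Pr => e e0.
have [s [xs sx]] := kaehler_norm_approx v x e0.
rewrite [kaehler_seminorm v A x]/(kaehler_norm v x).
move: (kaehler_norm v x + e) (addr_ge0 (kaehler_norm_ge0 v x) (ltW e0)) sx.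
move=> t t0 sx {e0}.
(* The ball of radius [t] is stable under sums, as [y + z = y - (- z)]. *)
have pD y z : p y <= t -> p z <= t -> p (y + z) <= t.
  move=> py pz; rewrite -[z]opprK; apply: le_trans (snormB p _ _) _.
  rewrite ge_max py -sub0r; apply: le_trans (snormB p _ _) _.
  by rewrite snorm0 ge_max t0.
rewrite xs big_seq; elim/big_rec: _ => [|q y qs py]; first by rewrite snorm0.
apply: pD py; apply: le_trans (sx q qs).
have [->|b0] := eqVneq q.2 0;
  first by rewrite kd0 scaler0 snorm0 mulr_ge0 ?absv_ge0.
pose b' : mulgrp K := Sub q.2 b0.
rewrite -[X in kd A X]/(val b') kd_dlog scalerA -absvM.
(* [p (dlog b') <= 1] because [dlog b'] lies in the lattice. *)
apply: le_trans (snormZ p _ _) _; apply: ler_piMr; first exact: absv_ge0.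
by apply: Lp; rewrite -[X in X \in _]scale1r dlog_lattice // absv1.
Qed.

(* With t = max(r, 1/2): if no value |c| lies in ]t, 1[, then none lies in
   ]1, 1/t[ and c = 1 will do. *)
Lemma value_gap (r : F) : r < 1 -> exists2 e : F, 0 < e &
  exists2 c : Ko, r < v (iv c) &
    forall x : K, v x <= 1 + e -> v (iv c * x) <= 1.
Proof.
move=> r1; pose t := Num.max r 2^-1.
have t0 : 0 < t by rewrite lt_max invr_gt0 ltr0n orbT.
have t1 : t < 1 by rewrite gt_max r1 invf_lt1 ?ltr0n // ltr1n.
have rt : r <= t by rewrite le_max lexx.
have [[c /andP[tc c1]]|nc] := pselect (exists c : K, t < v c < 1).
  have c0 : 0 < v c := lt_trans t0 tc.
  have [d dc] := intring_of (ltW c1).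
  (* Chosen so that [1 + e = 1 / |c|]. *)
  exists ((v c)^-1 - 1); first by rewrite subr_gt0 invf_gt1.
  exists d; first by rewrite dc (le_lt_trans rt).
  move=> x; rewrite addrC subrK dc absvM => xc.
  by rewrite -(mulfV (lt0r_neq0 c0)) ler_wpM2l // ltW.
(* Here [1 + e] is the midpoint of 1 and [1 / t], hence below [1 / t]. *)
exists ((t^-1 - 1) / 2).
  by rewrite divr_gt0 ?ltr0n // subr_gt0 invf_gt1.
exists 1; first by rewrite rmorph1 absv1.
move=> x xe; rewrite rmorph1 mul1r leNgt; apply/negP => x1; apply: nc.
have x0 : 0 < v x := lt_trans ltr01 x1.
exists x^-1; rewrite absvV invf_lt1 // x1 andbT.
rewrite -[t]invrK ltf_pV2 ?posrE ?invr_gt0 //; apply: le_lt_trans xe _.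
have : 1 < t^-1 by rewrite invf_gt1.
by move: (t^-1) => u u1; lra.
Qed.

(** Both inclusions are injective. The sum of the two modules is the unit ball, so the second
    cokernel vanishes; for each [r < 1] the first is killed by the [c] of [value_gap]. *)
Lemma log_lattice_almost :
  almost_unit_ball (log_lattice v A) (kaehler_seminorm v A).
Proof.
split; split; try by apply: almost_zero_unit => x; apply: incl_kerm0.
  move=> x r r1; elim/quotm_ind: x => x.
  have [e e0 [c rc cP]] := value_gap r1; exists c => //.
  have xB : submod_val x \in unit_ball (kaehler_seminorm v A).
    exact: addm_absorb log_lattice_unit_ball _ (valP x).
  have cx : c *: submod_val x \in log_lattice v A.
    (* Since [x] has norm at most 1, all terms have value at most [1 + e], which [c] brings down to
       1. *)
    have [s [xs sx]] := kaehler_norm_approx v (submod_val x : Om) e0.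
    rewrite restr_scaleE xs scaler_sumr big_seq; apply: rpred_sum => p ps.
    rewrite scalerA; apply: kd_lattice; rewrite absvM -mulrA -!absvM.
    apply: cP; rewrite absvM; apply: le_trans (sx p ps) _.
    by rewrite lerD2r; apply: xB.
  rewrite -linearZ -[RHS](raddf0 (quotm_pi _)); apply/quotm_pi_eq;
    rewrite subr0.
  apply/asboolP; exists (Sub (c *: submod_val x) cx).
  by apply: submod_val_inj; rewrite linearZ.
apply: almost_zero_unit; elim/quotm_ind => x.
rewrite -[RHS](raddf0 (quotm_pi _)); apply/quotm_pi_eq; rewrite subr0.
have xB : submod_val x \in unit_ball (kaehler_seminorm v A).
  exact: addm_absorb log_lattice_unit_ball _ (valP x).
by apply/asboolP; exists (Sub (submod_val x) xB); apply: submod_val_inj.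
Qed.
End Log.
End ValuedField.

(* The two injectivity claims of (i) fail when A is not contained in the
   fraction field of its intersection with the ring of integers (for example
   A = k[1/t] in k(t) with the t-adic valuation); they, and only they, are stated
   under that containment. *)
Theorem theorem5p1p8 (F : realType) (K : fieldType) (v : valuation F K)
    (A : subringClosed K) :
  [/\ (forall a : K, a \in A ->
         exists b c : K, [/\ b \in A, c \in A, v b <= 1 & v c <= 1] /\
           (c != 0) /\ a = b / c) ->
      bijective (loc_tensor v A) /\ injective (loc_tf v A)
    & semilattice (log_lattice v A)] /\
  [/\ {subset log_lattice v A <= unit_ball (kaehler_seminorm v A)},
      forall p : seminorm v (kaehler A),
        {subset log_lattice v A <= unit_ball p} ->
        forall x : kaehler A, p x <= kaehler_seminorm v A x
    & almost_unit_ball (log_lattice v A) (kaehler_seminorm v A)].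
Proof.
split; split.
- by move=> A_frac; split; [apply: loc_tensor_bij|apply: injective_loc_tf].
- exact: log_lattice_semilattice.
- exact: log_lattice_unit_ball.
- exact: kaehler_seminorm_max.
- exact: log_lattice_almost.
Qed.
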